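(* For a convex cone $E_+$ in a real vector space $E$, the following are equivalent: (i) $E_+$ is a closed proper cone with respect to the finest locally convex topology on $E$; (ii) There is a locally convex topology on $E$ for which $E_+$ is closed and regular; (iii) There is a locally convex topology on $E$ for which $E_+$ is a closed proper cone; (iv) There is a locally convex topology on $E$ for which $E_+$ is closed and normal; (v) There is a topological space $\Omega$ and an injective bipositive linear map $E \to C(\Omega)$; (vi) There is a locally compact Hausdorff space $\Omega$ and an injective bipositive linear map $E \to C(\Omega)$.
   Context: All locally convex topologies are Hausdorff. A convex cone is a non-empty subset $\mathcal{K}$ with $\mathcal{K}+\mathcal{K}\subseteq\mathcal{K}$ and $\lambda\mathcal{K}\subseteq\mathcal{K}$ for all $\lambda\ge0$; it is proper if $\mathcal{K}\cap-\mathcal{K}=\{0\}$. $E$ is preordered by $x\le y\iff y-x\in E_+$. The cone $E_+$ is regular (a purely algebraic property) if the set $E_+^*$ of all linear functionals $E\to\mathbb{R}$ that are non-negative on $E_+$ separates points on $E$, i.e. for every $x\neq0$ there is $\varphi\in E_+^*$ with $\varphi(x)\ne0$. The cone $E_+$ is normal for a locally convex topology if this topology has a base of $0$-neighbourhoods $U$ that are full (i.e. $x\le y\le z$ with $x,z\in U$ implies $y\in U$); equivalently, the topology is generated by a family of seminorms $\rho$ that are monotone ($0\le x\le y$ implies $\rho(x)\le\rho(y)$). $C(\Omega)$ is the vector space of continuous functions $\Omega\to\mathbb{R}$ with the cone of everywhere non-negative functions. A linear map $T:E\to F$ is bipositive if $E_+=T^{-1}[F_+]$. *)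

(* Defs.v *)
From HB Require Import structures.
From mathcomp Require Import all_boot all_order all_algebra.
From mathcomp Require Import all_classical all_reals all_analysis.

Set Implicit Arguments.
Unset Strict Implicit.
Unset Printing Implicit Defensive.

Import Order.TTheory GRing.Theory Num.Theory.
Import numFieldNormedType.Exports.

Local Open Scope classical_set_scope.
Local Open Scope ring_scope.

(* Closure under [bigcup] includes the empty union, hence [set0] is open. *)
Record topology_on (T : Type) := TopologyOn {
  opens : set (set T) ;
  opens_setT : opens setT ;
  opens_setI : setI_closed opens ;
  opens_bigcup : forall (I : Type) (f : I -> set T),
    (forall i, opens (f i)) -> opens (\bigcup_i f i) }.

(* The type [T] seen as the topological space whose topology is [tau]. *)
Definition topologized (T : Type) (tau : topology_on T) : Type := T.

HB.instance Definition _ (T : choiceType) (tau : topology_on T) :=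
  Choice.copy (topologized tau) T.

HB.instance Definition _ (T : choiceType) (tau : topology_on T) :=
  @isOpenTopological.Build (topologized tau)
    (opens tau) (opens_setT tau) (@opens_setI T tau) (@opens_bigcup T tau).

HB.instance Definition _ (R : realType) (E : lmodType R) (tau : topology_on E) :=
  GRing.Lmodule.copy (topologized tau) E.

Record lctopology (R : realType) (E : lmodType R) := LCTopology {
  lct_topology :> topology_on E ;
  lct_add_continuous : continuous
    (fun z : topologized lct_topology * topologized lct_topology => z.1 + z.2) ;
  lct_scale_continuous : continuous
    (fun z : R^o * topologized lct_topology => z.1 *: z.2) ;
  lct_locally_convex : exists2 B : set_system (topologized lct_topology),
    (forall b, b \in B -> convex_set b) & basis B ;
  lct_hausdorff : hausdorff_space (topologized lct_topology) }.

Definition lct_space (R : realType) (E : lmodType R) (tau : lctopology E) : Type :=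
  topologized tau.

Section lct_space_instances.
Context (R : realType) (E : lmodType R) (tau : lctopology E).

HB.instance Definition _ := GRing.Lmodule.copy (lct_space tau) (topologized tau).
HB.instance Definition _ := Topological.copy (lct_space tau) (topologized tau).
HB.instance Definition _ := @PreTopologicalLmod_isTvs.Build R (lct_space tau)
  (@lct_add_continuous R E tau) (@lct_scale_continuous R E tau)
  (@lct_locally_convex R E tau).
(* [PreTopologicalLmod_isTvs] only provides the uniform structure. *)
HB.instance Definition _ := PreTopologicalNmodule_isTopologicalNmodule.Build
  (lct_space tau) (@lct_add_continuous R E tau).
HB.instance Definition _ := TopologicalNmodule_isTopologicalLmodule.Build
  R (lct_space tau) (@lct_scale_continuous R E tau).
HB.instance Definition _ := Uniform_isTvs.Build
  R (lct_space tau) (@lct_locally_convex R E tau).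

End lct_space_instances.

Definition is_finest (R : realType) (E : lmodType R) (tau : lctopology E) : Prop :=
  forall sigma : lctopology E, opens sigma `<=` opens tau.

Section cones.
Context (R : realType) (E : lmodType R).
Implicit Type K : set E.

Definition convex_cone K : Prop :=
  [/\ K !=set0,
      (forall x y, K x -> K y -> K (x + y)) &
      (forall (r : R) x, 0 <= r -> K x -> K (r *: x))].

Definition proper_cone K : Prop := K `&` (-%R @` K) = [set 0].

Definition cone_le K (x y : E) : Prop := K (y - x).

Definition dual_cone K : set {linear E -> R^o} :=
  [set phi : {linear E -> R^o} | forall x, K x -> 0 <= phi x].

Definition regular_cone K : Prop :=
  forall x : E, x != 0 -> exists2 phi, dual_cone K phi & phi x != 0.

Definition closed_cone (tau : lctopology E) K : Prop :=
  closed (K : set (lct_space tau)).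

Definition full_set K (U : set E) : Prop :=
  forall x y z, cone_le K x y -> cone_le K y z -> U x -> U z -> U y.

Definition normal_cone (tau : lctopology E) K : Prop :=
  forall V, nbhs (0 : lct_space tau) V ->
    exists U, [/\ nbhs (0 : lct_space tau) U, full_set K U & U `<=` V].

End cones.

(* The vector space C(Omega): [continuousType Omega R^o] with the pointwise
   operations inherited from [Omega -> R^o]. *)
Section continuous_functions.
Context (R : realType) (Omega : topologicalType).

Definition cts_pred : {pred Omega -> R^o} := mem [set f | continuous f].

Definition cts_Sub (f : Omega -> R^o) (fP : f \in cts_pred) :
  continuousType Omega R^o := mkcts (set_mem fP).

Lemma cts_rect (P : continuousType Omega R^o -> Type) :
  (forall f (fP : f \in cts_pred), P (cts_Sub fP)) -> forall u, P u.
Proof.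
move=> PSub u.
have uP : (u : Omega -> R^o) \in cts_pred by apply: mem_set; exact: cts_fun.
by have <- : cts_Sub uP = u by apply/continuousEP.
Qed.

Lemma cts_valP (f : Omega -> R^o) (fP : f \in cts_pred) : cts_Sub fP = f :> (_ -> _).
Proof. by []. Qed.

HB.instance Definition _ :=
  isSub.Build _ _ (continuousType Omega R^o) cts_rect cts_valP.

Lemma cts_submod_closed : submod_closed cts_pred.
Proof.
split; first by apply: mem_set => x; exact: cvg_cst.
move=> a f g /set_mem fc /set_mem gc; apply: mem_set => x.
by apply: cvgD; [apply: cvgZr; exact: fc|exact: gc].
Qed.

HB.instance Definition _ :=
  GRing.isSubmodClosed.Build _ _ cts_pred cts_submod_closed.

HB.instance Definition _ :=
  [SubChoice_isSubLmodule of continuousType Omega R^o by <:].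

Definition nonneg_functions : set (continuousType Omega R^o) :=
  [set f | forall w, 0 <= f w].

End continuous_functions.

Arguments nonneg_functions : clear implicits.

Definition bipositive (R : realType) (E F : lmodType R) (K : set E) (L : set F)
  (T : E -> F) : Prop := K = T @^-1` L.

(* Main.v *)
From HB Require Import structures.
Require Import Defs.
From mathcomp Require Import all_boot all_order all_algebra.
From mathcomp Require Import all_classical all_reals all_analysis.
From mathcomp Require Import lra.

(** All six conditions say the same algebraic thing about the cone K: each
    point outside K is sent to a negative number by some linear functional
    that is nonnegative on K ([dual_determined]), and moreover K is proper,
    equivalently regular.

    If K is closed for some locally convex topology, the first half is the
    Hahn-Banach theorem ([closed_dual_determined]).  It is proved here through
    cones only: if x is outside K, take an absorbing absolutely convex U with
    x + U disjoint from K; the cone generated by K and by - (x + U) has - x as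
    an order unit and misses x.  By Zorn's lemma it lies in a maximal cone
    missing x, which is a total preorder ([maximal_cone]), and a total
    preorder with an order unit e carries the functional
    y |-> sup {t | t e <= y} ([total_cone_functional]).  Given this, proper
    implies regular because x <> 0 cannot have both x and - x in K; conversely
    regular or normal implies proper at once.

    Both topologies that have to be produced come from one construction.  For
    a cone K0 with separating dual, the absolutely convex, absorbing, K0-full
    sets form a base of neighbourhoods of 0 of a Hausdorff locally convex
    topology ([disk_lctopology]); they include the strips |phi| < r for phi in
    the dual of K0, so every K containing K0 and determined by its dual is
    closed ([disk_closed]).  For K0 = K this topology makes K normal.  For
    K0 = {0} fullness is vacuous, and the topology is the finest locally
    convex one ([finest_disk]).

    Finally the dual of K itself serves as the space Omega: with the discrete
    topology it is locally compact and Hausdorff, every function on it is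
    continuous, and evaluation x |-> (phi |-> phi x) is injective and
    bipositive ([discrete_embedding]).  Conversely, if E embeds bipositively
    into some C(Omega), the evaluations at the points of Omega are enough
    functionals ([bipositive_dual_determined]). *)

Set Implicit Arguments.
Unset Strict Implicit.
Unset Printing Implicit Defensive.

Import Order.TTheory GRing.Theory Num.Theory.
Import numFieldNormedType.Exports.

Local Open Scope classical_set_scope.
Local Open Scope ring_scope.

(** * Separating a point from a cone *)

Section cone_separation.
Context (R : realType) (E : lmodType R).
Implicit Types (C K U : set E) (e x y : E).

Lemma convex_cone0 C : convex_cone C -> C 0.
Proof. by case=> [[x Cx] _ Cs]; rewrite -(scale0r x); exact: Cs. Qed.

Definition order_unit C e := forall x, exists2 t : R, 0 <= t & C (t *: e + x).

Lemma order_unit_cone C e : convex_cone C -> order_unit C e -> C e.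
Proof.
move=> [_ _ Cs] /(_ e)[t t0 Ct].
have -> : e = (t + 1)^-1 *: (t *: e + e).
  by rewrite -[X in t *: e + X]scale1r -scalerDl scalerA mulVf ?scale1r//; lra.
by apply: Cs => //; rewrite invr_ge0; lra.
Qed.

(** By Zorn's lemma there is a maximal cone D above C that misses - e.  If
    neither x nor - x were in D, then - e would be of the form d + t x and
    also of the form d' - s x with s, t > 0, and a positive combination of
    the two cancels x and puts - e in D. *)
Lemma maximal_cone C e : convex_cone C -> ~ C (- e) ->
  exists D, [/\ convex_cone D, C `<=` D, ~ D (- e) & forall x, D x \/ D (- x)].
Proof.
move=> Ccone CNe.
(* the empty set is admitted because Zorn_bigcup includes the empty chain *)
pose P D := D = set0 \/ [/\ convex_cone D, C `<=` D & ~ D (- e)].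
have [|D [[D0|[Dcone CD DNe]] Dmax]] := @Zorn_bigcup E P.
- move=> F FP Ftot.
  have [[D [FD D0]]|noD] := pselect (exists D, F D /\ D <> set0); last first.
    left; apply/seteqP; split => // x [D FD Dx]; apply: noD; exists D.
    by split => // D0; rewrite D0 in Dx.
  have FPD A x : F A -> A x -> [/\ convex_cone A, C `<=` A & ~ A (- e)].
    by move=> FA Ax; have [A0|//] := FP _ FA; rewrite A0 in Ax.
  have /eqP/set0P[d Dd] := D0.
  have [[Dn _ _] CD _] := FPD _ _ FD Dd.
  right; split; last 2 first.
  + by move=> x Cx; exists D => //; exact: CD.
  + by move=> [A FA Ae]; have [_ _] := FPD _ _ FA Ae.
  split; first by exists d, D.
  + move=> x y [A FA Ax] [B FB By].
    have [[_ Aa _] _ _] := FPD _ _ FA Ax; have [[_ Ba _] _ _] := FPD _ _ FB By.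
    have [AB|BA] := Ftot _ _ FA FB.
      by exists B => //; apply: Ba => //; exact: AB.
    by exists A => //; apply: Aa => //; exact: BA.
  + move=> r x r0 [A FA Ax]; exists A => //.
    by have [[_ _ As] _ _] := FPD _ _ FA Ax; exact: As.
- exfalso; apply: (Dmax C); last by right; split.
  by rewrite D0; split => // /(_ 0 (convex_cone0 Ccone)).
- have [Dn Da Ds] := Dcone.
  (* adjoining to D a vector outside of D captures -e *)
  have adjoin x : ~ D x -> exists d t, [/\ D d, 0 < t & - e = d + t *: x].
    move=> Dx; apply: contrapT => noD.
    pose D' : set E := [set z | exists d t, [/\ D d, 0 <= t & z = d + t *: x]].
    apply: (Dmax D').
      split=> [z Dz|D'D]; first by exists z, 0; rewrite scale0r addr0.
      apply: Dx; apply: D'D; exists 0, 1; rewrite scale1r add0r.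
      by split => //; exact: convex_cone0.
    right; split.
    + split.
      * by exists 0, 0, 0; rewrite scale0r addr0; split => //; exact: convex_cone0.
      * move=> _ _ [d [t [Dd t0 ->]]] [d' [t' [Dd' t'0 ->]]].
        exists (d + d'), (t + t'); split; [exact: Da|exact: addr_ge0|].
        by rewrite scalerDl addrACA.
      * move=> r _ r0 [d [t [Dd t0 ->]]]; exists (r *: d), (r * t).
        by split; [exact: Ds|exact: mulr_ge0|rewrite scalerDr scalerA].
    + move=> z /CD Dz; exists z, 0.
      by rewrite scale0r addr0.
    + move=> [d [t [Dd]]]; rewrite le_eqVlt => /predU1P[<-|t0 eE].
        by rewrite scale0r addr0 => eE; apply: DNe; rewrite eE.
      by apply: noD; exists d, t.
  exists D; split => // x.
  have [|Dx] := pselect (D x); first by left.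
  have [|DNx] := pselect (D (- x)); first by right.
  have [d [t [Dd t0 dE]]] := adjoin _ Dx.
  have [d' [s [Dd' s0 d'E]]] := adjoin _ DNx.
  exfalso; apply: DNe.
  have -> : - e = (s + t)^-1 *: (s *: d + t *: d').
    have st : s + t != 0 by lra.
    apply: (scalerI st); rewrite scalerA mulfV// scale1r scalerDl.
    rewrite {1}dE d'E !scalerDr !scalerA scalerN (mulrC t s).
    by rewrite addrACA subrr addr0.
  apply: (Ds); first by rewrite invr_ge0; lra.
  by apply: Da; apply: (Ds) => //; exact: ltW.
Qed.

(** The cone C is the positive cone of a total preorder with order unit e, in
    which x lies above s e for small s and below s e for large s.  The cut
    point f x is additive and homogeneous because membership in C is. *)
Lemma total_cone_functional C e : convex_cone C -> order_unit C e ->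
    ~ C (- e) -> (forall x, C x \/ C (- x)) ->
  exists2 phi : {linear E -> R^o}, dual_cone C phi & phi e = 1.
Proof.
move=> Ccone Ce CNe Ctot; have [_ Ca Cs] := Ccone.
have eC := order_unit_cone Ccone Ce.
have Ccmp x s t : C (x - s *: e) -> C (t *: e - x) -> s <= t.
  move=> Cx Ct; rewrite leNgt; apply/negP => ts; apply: CNe.
  have -> : - e = (s - t)^-1 *: ((x - s *: e) + (t *: e - x)).
    have st : s - t != 0 by lra.
    apply: (scalerI st); rewrite scalerA mulfV// scale1r scalerN.
    by rewrite [RHS]addrC addrA subrK -scalerBl -scaleNr opprB.
  by apply: Cs; [rewrite invr_ge0; lra|exact: Ca].
pose S x : set R := [set t | C (x - t *: e)].
have Sn x : S x !=set0.
  by have [t _ Ct] := Ce x; exists (- t); rewrite /S/= scaleNr opprK addrC.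
have Sb x : has_ubound (S x).
  by have [t _ Ct] := Ce (- x); exists t => s /Ccmp; apply.
pose f x : R^o := sup (S x).
(* f x is the only cut point; this characterizes it without suprema *)
have fP x r : (forall s, s < r -> C (x - s *: e)) ->
    (forall s, r < s -> C (s *: e - x)) -> f x = r.
  move=> lo hi; apply/eqP; rewrite eq_le; apply/andP; split.
    apply/ler_addgt0Pr => d d0; apply: ge_sup => // s /Ccmp; apply.
    by apply: hi; rewrite ltrDl.
  apply/ler_addgt0Pr => d d0; rewrite -lerBlDr; apply: ub_le_sup => //.
  by apply: lo; rewrite ltrBlDr ltrDl.
have flo x s : s < f x -> C (x - s *: e).
  move=> sf; have [|t Ct] := @sup_adherent _ (S x) (f x - s) _ (conj (Sn x) (Sb x)).
    by rewrite subr_gt0.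
  rewrite subKr => st.
  have -> : x - s *: e = (x - t *: e) + (t - s) *: e.
    by rewrite scalerBl addrA subrK.
  by apply: Ca => //; apply: Cs => //; rewrite subr_ge0 ltW.
have fhi x s : f x < s -> C (s *: e - x).
  move=> fs; have [Cx|] := Ctot (x - s *: e); last by rewrite opprB.
  by have := ub_le_sup (Sb x) Cx; rewrite leNgt fs.
have fD x y : f (x + y) = f x + f y.
  (* the gap between s and f x + f y is shared evenly by x and y *)
  apply: fP => s sf; pose d := (f x + f y - s) / 2.
    have -> : x + y - s *: e = (x - (f x - d) *: e) + (y - (f y - d) *: e).
      rewrite addrACA -opprD -scalerDl; congr (_ - _ *: _).
      by rewrite /d; lra.
    by apply: Ca; apply: flo; rewrite /d; lra.
  have -> : s *: e - (x + y) = ((f x - d) *: e - x) + ((f y - d) *: e - y).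
    rewrite addrACA -opprD -scalerDl; congr (_ *: _ - _).
    by rewrite /d; lra.
  by apply: Ca; apply: fhi; rewrite /d; lra.
have fN x : f (- x) = - f x.
  apply: fP => s sf.
    have -> : - x - s *: e = (- s) *: e - x by rewrite scaleNr addrC.
    by apply: fhi; lra.
  have -> : s *: e - - x = x - (- s) *: e by rewrite scaleNr !opprK addrC.
  by apply: flo; lra.
have fZ0 a x : 0 < a -> f (a *: x) = a * f x.
  move=> a0; have sE s : s *: e = a *: ((s / a) *: e).
    by rewrite scalerA mulrCA mulfV ?mulr1// gt_eqF.
  apply: fP => s sf; rewrite (sE s) -scalerBr; apply: Cs (ltW a0) _.
    by apply: flo; rewrite ltr_pdivrMr// mulrC.
  by apply: fhi; rewrite ltr_pdivlMr// mulrC.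
have fZ a x : f (a *: x) = a * f x.
  have [a0|a0|->] := ltgtP a 0; [|exact: fZ0|].
    by rewrite -[a]opprK scaleNr fN fZ0 ?mulNr// oppr_gt0.
  rewrite scale0r mul0r; have := fD 0 0; rewrite addr0 => /eqP.
  by rewrite -subr_eq subrr => /eqP <-.
have flin : linear f by move=> a x y; rewrite fD fZ.
pose phi : {linear E -> R^o} := HB.pack f (GRing.isLinear.Build R E R^o _ f flin).
exists phi => [x Cx|] /=.
  by apply: ub_le_sup => //; rewrite /S/= scale0r subr0.
apply: fP => s s1.
  rewrite -[X in X - _]scale1r -scalerBl; apply: Cs => //; lra.
rewrite -[X in _ - X]scale1r -scalerBl; apply: Cs => //; lra.
Qed.


(** Convexity and balancedness in a single condition, which covers the
    degenerate combinations with |a| + |b| < 1. *)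
Definition absolutely_convex U := forall (a b : R) x y,
  `|a| + `|b| <= 1 -> U x -> U y -> U (a *: x + b *: y).

Definition absorbing U := forall x, exists2 s : R, 0 < s & U (s *: x).

Lemma absolutely_convexZ U (a : R) x :
  absolutely_convex U -> `|a| <= 1 -> U x -> U (a *: x).
Proof.
move=> Uc a1 Ux; rewrite -[_ *: _]addr0 -(scale0r x).
by apply: Uc => //; rewrite normr0 addr0.
Qed.

Lemma absorbing0 U : absolutely_convex U -> absorbing U -> U 0.
Proof.
move=> Uc /(_ 0)[s _ Us]; rewrite -(scale0r (s *: 0)).
by apply: absolutely_convexZ => //; rewrite normr0.
Qed.

Lemma absolutely_convex_shrink U (s t : R) x : absolutely_convex U ->
  0 < s -> U (s *: x) -> 0 <= t -> t <= s -> U (t *: x).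
Proof.
move=> Uc s0 Us t0 ts.
have -> : t *: x = (t / s) *: (s *: x) by rewrite scalerA divfK// gt_eqF.
apply: absolutely_convexZ => //.
by rewrite ger0_norm ?divr_ge0 ?(ltW s0)// ler_pdivrMr// mul1r.
Qed.

(** Hahn-Banach separation, with the topology reduced to an absorbing
    absolutely convex U such that x + U misses K.  In the cone generated by K
    and - (x + U), absorption makes - x an order unit, and x is missed:
    x + t (x + u) in K would put x + (t / (1 + t)) u in K. *)
Lemma cone_separation K U x : convex_cone K -> absolutely_convex U ->
    absorbing U -> (forall u, U u -> ~ K (x + u)) ->
  exists2 phi : {linear E -> R^o}, dual_cone K phi & phi x < 0.
Proof.
move=> Kcone Uc Ua KU; have [_ Ka Ks] := Kcone.
have U0 := absorbing0 Uc Ua; have K0 := convex_cone0 Kcone.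
pose C : set E :=
  [set y | exists t u, [/\ 0 <= t, U u & K (y + t *: (x + u))]].
have Ccone : convex_cone C.
  split.
  - by exists 0, 0, 0; split => //; rewrite scale0r addr0.
  - move=> y y' [t [u [t0 Uu Ky]]] [t' [u' [t'0 Uu' Ky']]].
    exists (t + t'), ((t / (t + t')) *: u + (t' / (t + t')) *: u').
    split; [exact: addr_ge0| |].
    + have T0 : 0 <= (t + t')^-1 by rewrite invr_ge0 addr_ge0.
      apply: Uc => //; rewrite !ger0_norm ?mulr_ge0// -mulrDl.
      by have [->|T] := eqVneq (t + t') 0; [rewrite mul0r|rewrite divff].
    + suff -> : (t + t') *: (x + ((t / (t + t')) *: u + (t' / (t + t')) *: u'))
          = t *: (x + u) + t' *: (x + u').
        by rewrite addrACA; exact: Ka.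
      have TE s : 0 <= s -> s <= t + t' -> (t + t') * (s / (t + t')) = s.
        have [T|T] := eqVneq (t + t') 0; last by rewrite mulrC divfK.
        by rewrite T mul0r => *; lra.
      by rewrite !scalerDr (scalerDl x) !scalerA addrACA !TE//; lra.
  - move=> r y r0 [t [u [t0 Uu Ky]]]; exists (r * t), u; split => //.
      exact: mulr_ge0.
    by rewrite -scalerA -scalerDr; exact: Ks.
have Cunit : order_unit C (- x).
  move=> y; have [s s0 Us] := Ua y.
  exists s^-1; first by rewrite invr_ge0 ltW.
  exists s^-1, (- 1 *: (s *: y)); split.
  - by rewrite invr_ge0 ltW.
  - by apply: absolutely_convexZ => //; rewrite normrN normr1.
  - suff -> : s^-1 *: - x + y + s^-1 *: (x + -1 *: (s *: y)) = 0 by [].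
    rewrite scalerDr scalerN scaleN1r scalerN scalerA mulVf ?gt_eqF// scale1r.
    by rewrite addrACA addNr subrr addr0.
have CNunit : ~ C (- - x).
  rewrite opprK => -[t [u [t0 Uu Kt]]].
  have t1 : 0 < 1 + t by lra.
  apply: (KU ((t / (1 + t)) *: u)).
    apply: absolutely_convexZ => //.
    by rewrite ger0_norm ?divr_ge0// ?ler_pdivrMr// ?mul1r; lra.
  suff -> : x + (t / (1 + t)) *: u = (1 + t)^-1 *: (x + t *: (x + u)).
    by apply: Ks => //; rewrite invr_ge0 ltW.
  have -> : x + t *: (x + u) = (1 + t) *: x + t *: u.
    by rewrite scalerDr addrA scalerDl scale1r.
  by rewrite scalerDr !scalerA mulVf ?gt_eqF// scale1r mulrC.
have [D [Dcone CD DNunit Dtot]] := maximal_cone Ccone CNunit.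
have Dunit : order_unit D (- x).
  by move=> y; have [t t0 /CD] := Cunit y; exists t.
have [phi Dphi phix] := total_cone_functional Dcone Dunit DNunit Dtot.
exists phi => [k Kk|]; last by have := linearN phi x; rewrite phix; lra.
by apply/Dphi/CD; exists 0, 0; rewrite scale0r addr0.
Qed.

End cone_separation.

(** * The locally convex topology of full disks *)

Section disk_topology.
Context (R : realType) (E : lmodType R).
Implicit Types (K U V O : set E) (x y : E).

(** The basic neighbourhoods of 0.  For K = {0} fullness is no restriction,
    which is how one construction yields both the finest locally convex
    topology and one that makes a given cone normal. *)
Definition full_disk K U := [/\ absolutely_convex U, absorbing U & full_set K U].

Lemma disk0 K U : full_disk K U -> U 0.
Proof. by case=> Uc Ua _; exact: absorbing0. Qed.

Lemma disk_setT K : full_disk K setT.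
Proof. by split => // x; exists 1. Qed.

Lemma disk_setI K U V : full_disk K U -> full_disk K V -> full_disk K (U `&` V).
Proof.
move=> [Uc Ua Uf] [Vc Va Vf]; split.
- by move=> a b x y ab [Ux Vx] [Uy Vy]; split; [exact: Uc|exact: Vc].
- move=> x; have [s s0 Us] := Ua x; have [t t0 Vt] := Va x.
  exists (Num.min s t); first by rewrite lt_min s0.
  have st0 : 0 <= Num.min s t by rewrite le_min !ltW.
  by split; [apply: (absolutely_convex_shrink Uc s0 Us)|apply: (absolutely_convex_shrink Vc t0 Vt)];
    rewrite // ge_min lexx ?orbT.
- move=> x y z xy yz [Ux Vx] [Uz Vz].
  by split; [exact: Uf xy yz Ux Uz|exact: Vf xy yz Vx Vz].
Qed.

Lemma disk_scale K U (c : R) : convex_cone K -> 0 < c -> full_disk K U ->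
  full_disk K [set x | U (c *: x)].
Proof.
move=> [_ _ Ks] c0 [Uc Ua Uf]; split.
- move=> a b x y ab Ux Uy /=.
  rewrite scalerDr !scalerA ![c * _]mulrC -!scalerA; exact: Uc.
- move=> x; have [s s0 Us] := Ua (c *: x).
  by exists s => //=; rewrite scalerA mulrC -scalerA.
- move=> x y z xy yz; apply: Uf; rewrite /cone_le -scalerBr.
    exact: Ks (ltW c0) xy.
  exact: Ks (ltW c0) yz.
Qed.

(** Continuity of the positive functionals, in terms of disks: strips are full
    because phi is monotone. *)
Lemma disk_strip K (phi : {linear E -> R^o}) (r : R) : dual_cone K phi ->
  0 < r -> full_disk K [set x | `|phi x| < r].
Proof.
move=> Kphi r0; split.
- move=> a b x y ab /= phix phiy.
  (* bounding by the maximum keeps the inequality strict when a = b = 0 *)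
  have m_r : Num.max `|phi x| `|phi y| < r by rewrite gt_max phix.
  apply: le_lt_trans m_r; rewrite linearD !linearZ /=.
  apply: le_trans (ler_normD _ _) _; rewrite !normrM.
  set m := Num.max _ _.
  have m0 : 0 <= m by rewrite le_max normr_ge0.
  apply: (@le_trans _ _ (`|a| * m + `|b| * m)).
    by apply: lerD; apply: ler_wpM2l => //; rewrite le_max lexx ?orbT.
  by rewrite -mulrDl ler_piMl.
- move=> x; have n0 : 0 < `|phi x| + 1 by rewrite ltr_wpDl.
  exists (r / (`|phi x| + 1)); first exact: divr_gt0.
  rewrite /= linearZ /= normrM gtr0_norm ?divr_gt0// mulrAC ltr_pdivrMr//.
  by rewrite ltr_pM2l// ltrDl.
- move=> x y z /Kphi xy /Kphi yz /=; rewrite !ltr_norml.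
  move: xy yz; rewrite !linearB /= => xy yz /andP[rx _] /andP[_ rz].
  by apply/andP; split; lra.
Qed.

Definition disk_open K O := forall x, O x ->
  exists2 U, full_disk K U & forall u, U u -> O (x + u).

Lemma disk_openT K : disk_open K setT.
Proof. by move=> x _; exists setT => //; exact: disk_setT. Qed.

Lemma disk_openI K : setI_closed (disk_open K).
Proof.
move=> A B oA oB x [/oA[U dU UA] /oB[V dV VB]].
exists (U `&` V); first exact: disk_setI.
by move=> u [Uu Vu]; split; [exact: UA|exact: VB].
Qed.

Lemma disk_open_bigcup K (I : Type) (f : I -> set E) :
  (forall i, disk_open K (f i)) -> disk_open K (\bigcup_i f i).
Proof.
move=> of_ x [i _ /of_[U dU Uf]]; exists U => // u Uu.
by exists i => //; exact: Uf.
Qed.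

Definition disk_topology K : topology_on E :=
  TopologyOn (@disk_openT K) (@disk_openI K) (@disk_open_bigcup K).

Section cone.
Variables (K : set E) (hK : convex_cone K).

Let T := topologized (disk_topology K).

Lemma disk_half U x y : absolutely_convex U -> U (2 *: x) -> U (2 *: y) -> U (x + y).
Proof.
move=> Uc Ux Uy.
have -> : x + y = 2^-1 *: (2 *: x) + 2^-1 *: (2 *: y).
  by rewrite !scalerA mulVf ?pnatr_eq0// !scale1r.
by apply: Uc => //; rewrite ger0_norm; lra.
Qed.

(** Halving disks gives the room needed for the points with a disk around them
    inside V to form an open set, whence disks are neighbourhoods of 0. *)
Lemma disk_interior_open V :
  disk_open K [set x | exists2 U, full_disk K U & forall u, U u -> V (x + u)].
Proof.
move=> x [U dU UV]; exists [set v | U (2 *: v)].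
  by apply: disk_scale => //; lra.
move=> v Uv; exists [set v | U (2 *: v)]; first by apply: disk_scale => //; lra.
by move=> u Uu; rewrite -addrA; apply: UV; apply: disk_half => //; case: dU.
Qed.

Lemma disk_nbhsP (x : T) V :
  nbhs x V <-> exists2 U, full_disk K U & forall u, U u -> V (x + u).
Proof.
rewrite nbhsE; split=> [[A [Ao Ax] AV]|[U dU UV]].
  by have [U dU UA] := Ao x Ax; exists U => // u /UA /AV.
exists [set y | exists2 U, full_disk K U & forall u, U u -> V (y + u)].
  by split; [exact: disk_interior_open|exists U].
by move=> y [W dW WV]; rewrite -[y]addr0; apply/WV/(disk0 dW).
Qed.

Lemma disk_add_continuous : continuous (fun z : T * T => z.1 + z.2).
Proof.
move=> [x y] V /disk_nbhsP[U dU UV] /=.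
have dU2 : full_disk K [set v | U (2 *: v)] by apply: disk_scale => //; lra.
exists ([set x + v | v in [set v | U (2 *: v)]],
        [set y + v | v in [set v | U (2 *: v)]]) => /=.
  by split; apply/disk_nbhsP; exists [set v | U (2 *: v)] => // u Uu; exists u.
move=> [a b] /= [[u Uu <-] [v Uv <-]]; rewrite addrACA; apply: UV.
by apply: disk_half => //; case: dU.
Qed.

(** (r + d) (x + u) - r x = d x + (r + d) u, and each of the two terms lies in
    half of the disk U when d and u are small. *)
Lemma disk_scale_continuous : continuous (fun z : R^o * T => z.1 *: z.2).
Proof.
move=> [r x] V /disk_nbhsP[U dU UV] /=; have [Uc Ua _] := dU.
pose c : R := 2 * (`|r| + 1).
have c0 : 0 < c by rewrite mulr_gt0// ltr_wpDl.
have [s s0 Us] := Ua x.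
pose d := Num.min 1 (s / 2).
have d0 : 0 < d by rewrite lt_min ltr01 divr_gt0.
exists (ball (r : R^o) d, [set x + v | v in [set v | U (c *: v)]]) => /=.
  split; first exact: nbhsx_ballx.
  apply/disk_nbhsP; exists [set v | U (c *: v)]; first exact: disk_scale.
  by move=> u Uu; exists u.
move=> [t b] /= [rt [u Uu <-]].
have {}rt : `|t - r| < d by rewrite distrC.
have -> : t *: (x + u) = r *: x + ((t - r) / s *: (s *: x) + t / c *: (c *: u)).
  rewrite !scalerA !divfK ?gt_eqF// addrA -scalerDl scalerDr.
  by congr (_ *: _ + _); lra.
apply: UV; apply: Uc => //.
have /andP[d1 ds] : (d <= 1) && (d <= s / 2) by rewrite -le_min.
have h1 : `|(t - r) / s| <= 1 / 2.
  rewrite normrM [`|s^-1|]gtr0_norm ?invr_gt0// ler_pdivrMr//; lra.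
have h2 : `|t / c| <= 1 / 2.
  rewrite normrM [`|c^-1|]gtr0_norm ?invr_gt0// ler_pdivrMr// /c.
  have := ler_normD (t - r) r; rewrite subrK; lra.
lra.
Qed.

Lemma convex_setP (A : set E) :
  convex_set (A : set (convex_lmodType E)) <->
  forall x y (t : R), 0 <= t -> t <= 1 -> A x -> A y -> A (t *: x + (1 - t) *: y).
Proof.
split=> [Ac x y t t0 t1 Ax Ay|Ac x y t /set_mem Ax /set_mem Ay].
  by have /set_mem := Ac x y (Itv01 t0 t1) (mem_set Ax) (mem_set Ay).
by apply/mem_set/Ac.
Qed.

(** The convex open sets form a basis since the interior of the convex set
    x + U is again convex. *)
Lemma disk_locally_convex : exists2 B : set_system T,
  (forall b, b \in B -> convex_set b) & basis B.
Proof.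
exists [set O : set T | open O /\ convex_set (O : set (convex_lmodType E))].
  by move=> b /set_mem[].
split; first by move=> A []. 
move=> x V /disk_nbhsP[U dU UV].
have [Uc Ua _] := dU.
exists [set y | exists2 W, full_disk K W & forall w, W w -> U (y - x + w)]; last first.
  move=> y [W dW WU] /=; rewrite -[y](subrKC x); apply: UV.
  by rewrite -[y - x]addr0; apply/WU/(disk0 dW).
split; last first.
  by exists U => // u; rewrite subrr add0r.
split.
  have -> : [set y | exists2 W, full_disk K W & forall w, W w -> U (y - x + w)] =
     [set y | exists2 W, full_disk K W & forall w, W w -> [set z | U (z - x)] (y + w)].
    by apply/seteqP; split=> y [W dW WU]; exists W => // w /WU /=; rewrite addrAC.
  exact: disk_interior_open.
apply/convex_setP => y z t t0 t1 [V1 dV1 V1U] [V2 dV2 V2U].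
exists (V1 `&` V2); first exact: disk_setI.
move=> w [V1w V2w].
have -> : t *: y + (1 - t) *: z - x + w
    = t *: (y - x + w) + (1 - t) *: (z - x + w).
  rewrite -!(addrA _ (- x)) !(scalerDr _ _ (- x + w)) [RHS]addrACA -scalerDl subrKC.
  by rewrite scale1r.
by apply: Uc; [rewrite !ger0_norm; lra|exact: V1U|exact: V2U].
Qed.

(** Distinct points are separated by a strip of a positive functional, so the
    dual cone has to separate points. *)
Hypothesis Kreg : regular_cone K.

Lemma disk_hausdorff : hausdorff_space T.
Proof.
move=> x y xy; apply: contrapT => /eqP; rewrite -subr_eq0 => /Kreg[phi Kphi phi0].
pose U := [set u | `|phi u| < `|phi (x - y)| / 2].
have dU : full_disk K U by apply: disk_strip => //; rewrite divr_gt0// normr_gt0.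
have nU (z : T) : nbhs z [set z + u | u in U].
  by apply/disk_nbhsP; exists U => // u Uu; exists u.
have [_ [[u Uu <-] [v Uv yvE]]] := xy _ _ (nU x) (nU y).
have xyE : phi (x - y) = phi v - phi u.
  by have := congr1 phi yvE; rewrite linearB !linearD /=; lra.
have := ler_normB (phi v) (phi u); rewrite -xyE.
by rewrite /U /= in Uu Uv; lra.
Qed.

Definition disk_lctopology : lctopology E :=
  LCTopology disk_add_continuous disk_scale_continuous disk_locally_convex
    disk_hausdorff.

End cone.
End disk_topology.

(** * Closed cones in arbitrary locally convex topologies *)

Section lctopology_theory.
Context (R : realType) (E : lmodType R).
Implicit Types (tau : lctopology E) (K O : set E) (x y : E).

Lemma convex_cone_set0 : convex_cone [set 0 : E].
Proof.
split=> [|x y -> ->|r x _ ->]; first by exists 0.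
  exact: addr0.
exact: scaler0.
Qed.

Lemma full_set_set0 (U : set E) : full_set [set 0] U.
Proof.
move=> x y z /eqP xy _ Ux _; suff -> : y = x by [].
by apply/eqP; rewrite -subr_eq0.
Qed.

Lemma lct_radial tau x y (V : set E) : nbhs (x : topologized tau) V ->
  exists2 s : R, 0 < s & forall t, `|t| <= s -> V (x + t *: y).
Proof.
move=> Vx; have := @lct_add_continuous _ _ tau (x, 0) V.
rewrite /= addr0 => /(_ Vx)[[P Q] /= [Px Q0] PQV].
have := @lct_scale_continuous _ _ tau (0, y) Q.
rewrite /= scale0r => /(_ Q0)[[A B] /= [/nbhs_ballP[e /= e0 eA] By] ABQ].
exists (e / 2); first exact: divr_gt0.
move=> t te; apply: (PQV (x, t *: y)); split; first exact: nbhs_singleton Px.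
apply: (ABQ (t, y)); split; last exact: nbhs_singleton By.
by apply: eA; rewrite -ball_normE /= sub0r normrN; lra.
Qed.

(** Every locally convex topology is coarser than the topology of all absorbing
    absolutely convex sets: inside O there is a convex open b around x, and
    the symmetric part (b - x) meet (x - b) is absolutely convex and, by
    continuity of t |-> x + t y, absorbing. *)
Lemma lct_open_disk tau O x : opens tau O -> O x ->
  exists2 U, full_disk [set 0] U & forall u, U u -> O (x + u).
Proof.
move=> oO Ox; have [B Bconvex [Bopen Bbase]] := lct_locally_convex tau.
have Onbhs : nbhs (x : topologized tau) O by exact: open_nbhs_nbhs.
have [b [Bb bx] bO] := Bbase x O Onbhs.
have bc : forall y z (t : R), 0 <= t -> t <= 1 -> b y -> b z ->
  b (t *: y + (1 - t) *: z) by exact/convex_setP/Bconvex/mem_set.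
have bnbhs : nbhs (x : topologized tau) b.
  by apply: open_nbhs_nbhs; split => //; exact: Bopen.
pose U := [set u | b (x + u) /\ b (x - u)].
have UN u : U u -> U (- u) by move=> [? ?]; split; rewrite ?opprK.
have U0 : U 0 by split; rewrite ?subr0 ?addr0.
have Uc y z (t : R) : 0 <= t -> t <= 1 -> U y -> U z -> U (t *: y + (1 - t) *: z).
  move=> t0 t1 [y1 y2] [z1 z2]; split.
    have -> : x + (t *: y + (1 - t) *: z) = t *: (x + y) + (1 - t) *: (x + z).
      by rewrite !scalerDr [RHS]addrACA -scalerDl subrKC scale1r.
    exact: bc.
  have -> : x - (t *: y + (1 - t) *: z) = t *: (x - y) + (1 - t) *: (x - z).
    by rewrite !scalerBr [RHS]addrACA -scalerDl subrKC scale1r opprD.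
  exact: bc.
have Us (a : R) u : `|a| <= 1 -> U u -> U (a *: u).
  move=> a1 Uu; have [a0|a0] := leP 0 a.
    have -> : a *: u = a *: u + (1 - a) *: 0 by rewrite scaler0 addr0.
    by rewrite ger0_norm// in a1; exact: Uc.
  have -> : a *: u = - a *: - u + (1 - - a) *: 0.
    by rewrite scaler0 addr0 scaleNr scalerN opprK.
  by rewrite ltr0_norm// in a1; apply: Uc => //; [lra|exact: UN].
exists U; last by move=> u [bu _]; exact: bO.
split; last exact: full_set_set0.
- move=> a c y z ac Uy Uz.
  have [c0|c0] := eqVneq `|c| 1.
    have -> : a = 0 by apply/eqP; rewrite -normr_le0; lra.
    by rewrite scale0r add0r; apply: Us => //; rewrite c0.
  have c1 : 0 < 1 - `|c| by rewrite subr_gt0 lt_neqAle c0; have := normr_ge0 a; lra.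
  (* a and c are split off as convex weights 1 - |c| and |c| *)
  have -> : a *: y + c *: z = (1 - `|c|) *: ((a / (1 - `|c|)) *: y)
     + (1 - (1 - `|c|)) *: (Num.sg c *: z).
    by rewrite !scalerA mulrC divfK ?gt_eqF// subKr mulrC -numEsg.
  apply: Uc; [exact: ltW|have := normr_ge0 c; lra| |].
    apply: Us => //; rewrite normrM [`|_^-1|]gtr0_norm ?invr_gt0//.
    by rewrite ler_pdivrMr//; lra.
  by apply: Us => //; rewrite normr_sg lern1; case: (_ != 0).
- move=> y; have [s s0 sb] := lct_radial y bnbhs.
  exists s => //; split; first by apply: sb; rewrite gtr0_norm.
  by rewrite -scaleNr; apply: sb; rewrite normrN gtr0_norm.
Qed.

(** K equals its bidual cone, in the algebraic duality between E and all its
    linear functionals. *)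
Definition dual_determined K :=
  forall x, ~ K x -> exists2 phi, dual_cone K phi & phi x < 0.

Lemma closed_dual_determined tau K :
  convex_cone K -> closed_cone tau K -> dual_determined K.
Proof.
move=> Kcone Kclosed x Kx.
have oK : opens tau (~` K) by exact: closed_openC Kclosed.
have [U [Uc Ua _] UK] := lct_open_disk oK Kx.
exact: cone_separation Kcone Uc Ua UK.
Qed.

Lemma regular_proper K : convex_cone K -> regular_cone K -> proper_cone K.
Proof.
move=> Kcone Kreg; apply/seteqP; split; last first.
  move=> _ ->; have K0 := convex_cone0 Kcone.
  by split => //; exists 0 => //; rewrite oppr0.
move=> z [Kz [y Ky zE]]; rewrite -{}zE /= in Kz *; apply: contrapT => /eqP /Kreg[phi Kphi]; move: (Kphi _ Kz).
by rewrite linearN /= oppr_eq0 oppr_ge0 eq_le (Kphi _ Ky) andbT => ->.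
Qed.

Lemma proper_regular K :
  proper_cone K -> dual_determined K -> regular_cone K.
Proof.
move=> Kproper Kdual x x0.
have [Kx|/Kdual[phi Kphi phix]] := pselect (K x); last first.
  by exists phi => //; rewrite lt_eqF.
have [KNx|/Kdual[phi Kphi]] := pselect (K (- x)); last first.
  by rewrite linearN /= => phix; exists phi => //; lra.
have : (K `&` (-%R @` K)) x by split => //; exists (- x) => //; rewrite opprK.
by rewrite Kproper => /eqP; rewrite (negPf x0).
Qed.

Lemma regularS K K' : K `<=` K' -> regular_cone K' -> regular_cone K.
Proof.
by move=> KK' K'reg x /K'reg[phi phi0 phix]; exists phi => // y /KK' /phi0.
Qed.

(** * The topologies and function spaces attached to a cone *)

Section disk_lct.
Variables (K0 K : set E) (K0cone : convex_cone K0) (K0reg : regular_cone K0).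

Lemma disk_closed : K0 `<=` K -> dual_determined K ->
  closed_cone (disk_lctopology K0cone K0reg) K.
Proof.
move=> K0K Kdual; rewrite /closed_cone -openC.
suff : disk_open K0 (~` K) by exact.
move=> x /Kdual[phi Kphi phix].
exists [set u | `|phi u| < - phi x].
  by apply: disk_strip; [move=> y /K0K /Kphi|lra].
move=> u /= phiu /Kphi; rewrite linearD /=; have := ler_norm (phi u); lra.
Qed.

End disk_lct.

Lemma disk_normal K (Kcone : convex_cone K) (Kreg : regular_cone K) :
  normal_cone (disk_lctopology Kcone Kreg) K.
Proof.
move=> V /(disk_nbhsP Kcone)[U dU UV]; exists U; split; last 2 first.
- by case: dU.
- by move=> u /UV; rewrite add0r.
by apply/(disk_nbhsP Kcone); exists U => // u; rewrite add0r.
Qed.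

(** If x and - x are in K then 0 <= - x <= 0, so - x lies in every full
    neighbourhood of 0, and the topology is Hausdorff. *)
Lemma normal_proper tau K : convex_cone K -> normal_cone tau K -> proper_cone K.
Proof.
move=> Kcone Knormal; have K0 := convex_cone0 Kcone.
apply/seteqP; split; last first.
  by move=> _ ->; split => //; exists 0 => //; rewrite oppr0.
move=> z [Kz [x Kx zE]]; rewrite -{}zE /= in Kz *; apply: (lct_hausdorff (l := tau)) => A B Ax B0.
have [U [U0 Ufull UB]] := Knormal _ B0.
exists (- x); split; first exact: nbhs_singleton Ax.
apply: UB; apply: (Ufull 0 _ 0); rewrite /cone_le ?subr0 ?sub0r ?opprK//.
all: exact: (nbhs_singleton U0).
Qed.

Lemma finest_disk (set0reg : regular_cone [set 0 : E]) :
  is_finest (disk_lctopology convex_cone_set0 set0reg).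
Proof.
move=> sigma O oO; suff : disk_open [set 0] O by [].
by move=> x Ox; exact: lct_open_disk oO Ox.
Qed.

(** The points of Omega are the positive functionals themselves; the discrete
    topology makes all evaluations continuous. *)
Lemma discrete_embedding K : convex_cone K -> regular_cone K ->
    dual_determined K ->
  exists (Omega : discreteTopologicalType)
         (T : {linear E -> continuousType Omega R^o}),
    injective T /\ bipositive K (nonneg_functions R Omega) T.
Proof.
move=> Kcone Kreg Kdual.
pose Omega : discreteTopologicalType :=
  discrete_topology {classic {phi | dual_cone K phi}}.
pose ev x (w : Omega) : R^o := sval w x.
have evc x : ev x \in @cts_pred R Omega.
  apply/mem_set => w V /nbhs_singleton Vw.
  by apply: (@filterS _ _ _ _ (ev x @^-1` V) _ (discrete_set1 w)) => _ ->.
pose T x : continuousType Omega R^o := cts_Sub (evc x).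
have Tlin : linear T.
  move=> a x y; apply: val_inj; apply/funext => w.
  exact: (linearP (sval w)).
pose TL : {linear E -> continuousType Omega R^o} :=
  HB.pack T (GRing.isLinear.Build R E (continuousType Omega R^o) _ T Tlin).
exists Omega, TL; split=> /=.
- move=> x y Txy; apply: contrapT => /eqP; rewrite -subr_eq0 => /Kreg[phi Kphi].
  rewrite linearB subr_eq0 => /eqP; apply.
  exact: (congr1 (fun f : continuousType Omega R^o => f (exist _ phi Kphi)) Txy).
- apply/seteqP; split=> [x Kx [phi Kphi]|x Tx]; first exact: Kphi.
  apply: contrapT => /Kdual[phi Kphi].
  by have := Tx (exist _ phi Kphi); rewrite /= /ev /=; lra.
Qed.

Lemma discrete_locally_compact (Omega : discreteTopologicalType) :
  locally_compact [set: Omega].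
Proof.
move=> x _; exists [set x]; rewrite ?withinET; first exact: discrete_set1.
by split; [exact: compact_set1|exact: discrete_closed].
Qed.

Lemma bipositive_dual_determined K (Omega : topologicalType)
    (T : {linear E -> continuousType Omega R^o}) :
  injective T -> bipositive K (nonneg_functions R Omega) T ->
  regular_cone K /\ dual_determined K.
Proof.
move=> Tinj Tpos.
have ev (w : Omega) : exists phi : {linear E -> R^o}, forall x, phi x = T x w.
  pose f x : R^o := T x w.
  have flin : linear f by move=> a x y; rewrite /f linearP.
  pose phi : {linear E -> R^o} := HB.pack f (GRing.isLinear.Build R E R^o _ f flin).
  by exists phi.
have Kev w (phi : {linear E -> R^o}) : (forall x, phi x = T x w) -> dual_cone K phi.
  by move=> phiE x; rewrite Tpos phiE; apply.
split=> [x /eqP x0|x]; last first.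
  rewrite Tpos => /existsNP[w]; have [phi phiE] := ev w.
  move=> /negP; rewrite -ltNge => Txw.
  by exists phi; [rewrite -Tpos; exact: Kev phiE|rewrite phiE].
apply: contrapT => nophi; apply/x0/Tinj; rewrite linear0.
apply/continuousEP => w; have [phi phiE] := ev w.
apply/eqP/negP => Txw; apply: nophi; exists phi; first exact: Kev phiE.
by rewrite phiE; apply/negP.
Qed.

End lctopology_theory.

Theorem corollary5p2 (R : realType) (E : lmodType R) (K : set E)
    (hK : convex_cone K) :
  [<->
    (* (i) *)
    exists2 tau : lctopology E,
      is_finest tau & closed_cone tau K /\ proper_cone K;
    (* (ii) *)
    exists tau : lctopology E, closed_cone tau K /\ regular_cone K;
    (* (iii) *)
    exists tau : lctopology E, closed_cone tau K /\ proper_cone K;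
    (* (iv) *)
    exists tau : lctopology E, closed_cone tau K /\ normal_cone tau K;
    (* (v) *)
    exists (Omega : topologicalType)
           (T : {linear E -> continuousType Omega R^o}),
      injective T /\ bipositive K (nonneg_functions R Omega) T;
    (* (vi) *)
    exists (Omega : topologicalType)
           (T : {linear E -> continuousType Omega R^o}),
      [/\ locally_compact [set: Omega], hausdorff_space Omega,
          injective T & bipositive K (nonneg_functions R Omega) T] ].
Proof.
tfae.
- move=> [tau _ [Kclosed Kproper]]; exists tau; split => //.
  exact/proper_regular/(closed_dual_determined hK Kclosed).
- by move=> [tau [Kclosed Kreg]]; exists tau; split => //; exact: regular_proper.
- move=> [tau [Kclosed Kproper]].
  have Kdual := closed_dual_determined hK Kclosed.
  have Kreg := proper_regular Kproper Kdual.
  exists (disk_lctopology hK Kreg).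
  by split; [exact: disk_closed|exact: disk_normal].
- move=> [tau [Kclosed Knormal]].
  have Kdual := closed_dual_determined hK Kclosed.
  have Kreg := proper_regular (normal_proper hK Knormal) Kdual.
  have [X [T TP]] := discrete_embedding hK Kreg Kdual.
  by exists X, T.
- move=> [X [T [Tinj Tpos]]].
  have [Kreg Kdual] := bipositive_dual_determined Tinj Tpos.
  have [Y [S [Sinj Spos]]] := discrete_embedding hK Kreg Kdual.
  exists Y, S; split => //; first exact: discrete_locally_compact.
  exact: discrete_hausdorff.
- move=> [X [T [_ _ Tinj Tpos]]].
  have [Kreg Kdual] := bipositive_dual_determined Tinj Tpos.
  have set0K : [set 0] `<=` K by move=> _ ->; exact: convex_cone0.
  exists (disk_lctopology (@convex_cone_set0 R E) (regularS set0K Kreg)).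
    exact: finest_disk.
  by split; [exact: disk_closed|exact: regular_proper].
Qed.
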